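(* For $i=1,2$ consider forward complete systems $\Sigma_i:\ \frac{d}{dt}x_i(t)=f_i(x_i(t),w_i(t))$ with $x_i(0)\in\mathbb{R}^{n_i}$, $w_i\in\mathcal{W}^{m_i}$, where $f_i:\mathbb{R}^{n_i}\times\mathbb{R}^{m_i}\to\mathbb{R}^{n_i}$ is locally Lipschitz in its first argument, locally uniformly in its second argument, and $m_1=n_2$, $m_2=n_1$. Suppose that there are $\beta_i,\gamma_i\in\mathcal{K}_\infty$ such that, for $i=1,2$, $$\|x_i\|_{\mathcal{L}_2[0,t]}^2\le\max\left\{\beta_i(|x_i(0)|),\ \gamma_i\left(\|w_i\|_{\mathcal{L}_2[0,t]}^2\right)\right\}$$ for all $x_i(0)\in\mathbb{R}^{n_i}$, $w_i\in\mathcal{W}^{m_i}$, $t\in\mathbb{R}_{\ge0}$. Consider the feedback interconnection given by $w_1=x_2$ and $w_2=x_1$, assumed forward complete. If the small-gain conditions $$\mathrm{Id}-\gamma_i\circ\gamma_j\in\mathcal{K}_\infty$$ are satisfied for $i,j=1,2$, $i\ne j$, then the interconnected system is $\mathcal{L}_2$-stable; that is, there exists $\beta\in\mathcal{K}_\infty$ such that $\|x\|_{\mathcal{L}_2[0,t]}^2\le\beta(|x(0)|)$ for all $x(0)\in\mathbb{R}^{n_1+n_2}$ and $t\ge0$, where $x=[x_1^T\ x_2^T]^T$.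
   Context: $\mathcal{W}^m$ is the set of measurable, locally essentially bounded functions $w:\mathbb{R}_{\ge0}\to\mathbb{R}^m$. Forward complete means that for every initial condition and every input in the input class (if any) the solution exists for all $t\ge 0$. $\mathcal{K}_\infty$ is the class of continuous, strictly increasing, unbounded functions $\alpha:\mathbb{R}_{\ge0}\to\mathbb{R}_{\ge0}$ with $\alpha(0)=0$. $\mathrm{Id}$ is the identity on $\mathbb{R}_{\ge0}$; $\mathrm{Id}-g\in\mathcal{K}_\infty$ means that $s\mapsto s-g(s)$ is of class $\mathcal{K}_\infty$. $|\cdot|$ is the Euclidean norm, and $\|y\|_{\mathcal{L}_2[0,t]}^2:=\int_0^t|y(\tau)|^2d\tau$. *)

(* Defs.v *)
From HB Require Import structures.
From mathcomp Require Import all_boot all_order all_algebra.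
From mathcomp Require Import all_classical all_reals all_analysis.
Set Implicit Arguments.
Unset Strict Implicit.
Unset Printing Implicit Defensive.
Import Order.TTheory GRing.Theory Num.Theory.
Import numFieldNormedType.Exports.
Local Open Scope classical_set_scope.
Local Open Scope ring_scope.

(* Functions on R_{>=0} are represented by functions on R; only their values on
   [0, +oo[ are ever constrained or used. *)

(* The norm of the normedModType 'cV[R]_n is the sup norm, hence this one. *)
Definition enorm (R : realType) (n : nat) (v : 'cV[R]_n) : R :=
  Num.sqrt (\sum_i v i ord0 ^+ 2).

(* Nonnegativity of alpha on [0, +oo[ follows from alpha 0 = 0 and strict
   monotonicity. *)
Definition class_Kinf (R : realType) (alpha : R -> R) : Prop :=
  [/\ {within `[0, +oo[, continuous alpha},
      forall s t, 0 <= s -> s < t -> alpha s < alpha t,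
      alpha 0 = 0
    & forall M, exists2 s, 0 <= s & M < alpha s].

(* R with the sigma-algebra of Lebesgue-measurable sets, on which the completed
   Lebesgue measure is defined ([lebesgue_measure] lives on the Borel sets). *)
Notation lebesgue_type R := (caratheodory_type (wlength (R:=R) idfun)^*%mu).

Definition lebesgue_measurable_fun (R : realType) (D : set R) (f : R -> R) :
    Prop :=
  @measurable_fun _ _ (lebesgue_type R) R D f.

(* Measurability is componentwise, i.e. with respect to the Borel sets of R^m. *)
Definition input_class (R : realType) (m : nat) (w : R -> 'cV[R]_m) : Prop :=
  (forall i, lebesgue_measurable_fun `[0, +oo[ (fun t => w t i ord0)) /\
  (forall T, 0 <= T -> exists M : R,
     {ae @completed_lebesgue_measure R,
        forall t : R, 0 <= t <= T -> enorm (w t) <= M}).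

(* The squared L_2[0,t]-norm. It is applied only to elements of the input class
   and to solutions, for which the integral is finite, so that the convention
   fine +oo = 0 hidden in the real-valued integral plays no role. *)
Definition L2sq (R : realType) (n : nat) (y : R -> 'cV[R]_n) (t : R) : R :=
  Rintegral (@completed_lebesgue_measure R) `[0, t]
    (fun s : R => enorm (y s) ^+ 2).

Definition loc_absolutely_continuous (R : realType) (n : nat)
    (x : R -> 'cV[R]_n) : Prop :=
  forall T eps : R, 0 <= T -> 0 < eps -> exists2 delta : R, 0 < delta &
    forall (N : nat) (a b : 'I_N -> R),
      (forall k, [/\ 0 <= a k, a k <= b k & b k <= T]) ->
      trivIset setT (fun k => [set` `]a k, b k[]) ->
      \sum_k (b k - a k) < delta ->
      \sum_k enorm (x (b k) - x (a k)) < eps.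

(* Solutions are understood in the sense of Caratheodory, since inputs are only
   measurable. *)
Definition is_solution (R : realType) (n : nat)
    (g : R -> 'cV[R]_n -> 'cV[R]_n) (x : R -> 'cV[R]_n) : Prop :=
  loc_absolutely_continuous x /\
  {ae @completed_lebesgue_measure R,
     forall t : R, 0 < t -> is_derive t 1 x (g t (x t))}.

Definition is_input_solution (R : realType) (n m : nat)
    (f : 'cV[R]_n -> 'cV[R]_m -> 'cV[R]_n)
    (w : R -> 'cV[R]_m) (x : R -> 'cV[R]_n) : Prop :=
  is_solution (fun t z => f z (w t)) x.

Definition is_autonomous_solution (R : realType) (n : nat)
    (g : 'cV[R]_n -> 'cV[R]_n) (x : R -> 'cV[R]_n) : Prop :=
  is_solution (fun _ => g) x.

(* No uniqueness clause: for a system with inputs it follows from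
   [lipschitz_loc_unif]; for an autonomous system it is not required. *)
Definition forward_complete (R : realType) (n m : nat)
    (f : 'cV[R]_n -> 'cV[R]_m -> 'cV[R]_n) : Prop :=
  forall (x0 : 'cV[R]_n) (w : R -> 'cV[R]_m), input_class w ->
    exists2 x, is_input_solution f w x & x 0 = x0.

Definition forward_complete_autonomous (R : realType) (n : nat)
    (g : 'cV[R]_n -> 'cV[R]_n) : Prop :=
  forall x0 : 'cV[R]_n, exists2 x, is_autonomous_solution g x & x 0 = x0.

(* Locally Lipschitz in the first argument, locally uniformly in the second. *)
Definition lipschitz_loc_unif (R : realType) (n m : nat)
    (f : 'cV[R]_n -> 'cV[R]_m -> 'cV[R]_n) : Prop :=
  forall (x0 : 'cV[R]_n) (w0 : 'cV[R]_m),
    exists (U : set 'cV[R]_n) (V : set 'cV[R]_m) (L : R),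
      [/\ nbhs x0 U, nbhs w0 V &
          forall x y w, U x -> U y -> V w ->
            enorm (f x w - f y w) <= L * enorm (x - y)].

Definition L2_gain_estimate (R : realType) (n m : nat)
    (f : 'cV[R]_n -> 'cV[R]_m -> 'cV[R]_n) (beta gamma : R -> R) : Prop :=
  forall (w : R -> 'cV[R]_m) (x : R -> 'cV[R]_n) (t : R),
    input_class w -> is_input_solution f w x -> 0 <= t ->
    L2sq x t <= Num.max (beta (enorm (x 0))) (gamma (L2sq w t)).

(* The feedback w1 = x2, w2 = x1, with state x = [x1^T x2^T]^T. *)
Definition interconnection (R : realType) (n1 n2 : nat)
    (f1 : 'cV[R]_n1 -> 'cV[R]_n2 -> 'cV[R]_n1)
    (f2 : 'cV[R]_n2 -> 'cV[R]_n1 -> 'cV[R]_n2)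
    (x : 'cV[R]_(n1 + n2)) : 'cV[R]_(n1 + n2) :=
  col_mx (f1 (usubmx x) (dsubmx x)) (f2 (dsubmx x) (usubmx x)).

Definition L2_stable (R : realType) (n : nat) (g : 'cV[R]_n -> 'cV[R]_n) :
    Prop :=
  exists2 beta : R -> R, class_Kinf beta &
    forall (x : R -> 'cV[R]_n) (t : R),
      is_autonomous_solution g x -> 0 <= t -> L2sq x t <= beta (enorm (x 0)).

(* Main.v *)
(* Along a solution x = (x1, x2) of the feedback loop put y_i = |x_i|^2 in
   L_2[0,t]. The gain estimates give y1 <= max(b1, gamma1 y2) and
   y2 <= max(b2, gamma2 y1). Substituting the second into the first leaves
   either y1 <= b1, or y1 <= gamma1 b2, or y1 <= gamma1 (gamma2 y1), and the
   last forces y1 = 0 because s - gamma1 (gamma2 s) > 0 for s > 0. Hence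
   y1 <= b1 + gamma1 b2, and symmetrically for y2. The estimates apply because
   x1 and x2 are absolutely continuous, hence continuous, hence admissible
   inputs; finiteness of y1 and y2 makes the real-valued integral additive. *)

Require Import Defs.
From HB Require Import structures.
From mathcomp Require Import all_boot all_order all_algebra.
From mathcomp Require Import all_classical all_reals all_analysis.
Set Implicit Arguments.
Unset Strict Implicit.
Unset Printing Implicit Defensive.
Import Order.TTheory GRing.Theory Num.Theory.
Import numFieldNormedType.Exports.
Local Open Scope classical_set_scope.
Local Open Scope ring_scope.

(** * Class K-infinity functions and the scalar small-gain argument *)

Lemma Kinf_ge0 (R : realType) (a : R -> R) (s : R) :
  class_Kinf a -> 0 <= s -> 0 <= a s.
Proof.
move=> [_ inc a0 _]; rewrite le_eqVlt => /predU1P[<-|s0]; first by rewrite a0.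
by rewrite -a0 ltW// inc.
Qed.

Lemma Kinf_le (R : realType) (a : R -> R) (s t : R) :
  class_Kinf a -> 0 <= s -> s <= t -> a s <= a t.
Proof.
move=> [_ inc _ _] s0; rewrite le_eqVlt => /predU1P[->//|st].
by rewrite ltW// inc.
Qed.

Lemma class_KinfD (R : realType) (a b : R -> R) :
  class_Kinf a -> class_Kinf b -> class_Kinf (fun s => a s + b s).
Proof.
move=> aK bK; have [ac ai a0 au] := aK; have [bc bi b0 _] := bK; split.
- exact: (@within_continuousD _ R R).
- by move=> s t s0 st; rewrite ltrD ?ai ?bi.
- by rewrite a0 b0 addr0.
- move=> M; have [s s0 Ms] := au M; exists s => //.
  by rewrite (lt_le_trans Ms)// lerDl Kinf_ge0.
Qed.

Lemma class_Kinf_comp (R : realType) (a b : R -> R) :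
  class_Kinf a -> class_Kinf b -> class_Kinf (fun s => a (b s)).
Proof.
move=> aK bK; have [ac ai a0 au] := aK; have [bc bi b0 bu] := bK; split.
- apply/subspace_continuousP => s /= s0.
  move/subspace_continuousP : ac => /(_ (b s)) /=.
  move: s0; rewrite !in_itv/= !andbT => s0 /(_ (Kinf_ge0 bK s0)) ac.
  move/subspace_continuousP : bc => /(_ s) /=.
  rewrite in_itv/= andbT => /(_ s0) bc.
  (* [a] is continuous only relative to [[0, +oo[], so [b] must also be seen to keep points of this
     half-line inside it. *)
  apply: cvg_comp ac => A /=; rewrite /within/= nbhs_simpl/= => /bc.
  rewrite nbhs_simpl/=; apply: filterS2 (withinT _ _) => u /= u0; apply.
  by move: u0; rewrite !in_itv/= !andbT => /(Kinf_ge0 bK).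
- by move=> s t s0 st; rewrite ai ?bi ?(Kinf_ge0 bK).
- by rewrite b0 a0.
- move=> M; have [s s0 Ms] := au M; have [t t0 st] := bu s.
  by exists t => //; rewrite (lt_trans Ms)// ai.
Qed.

(** Scalar core, used for both subsystems with the indices exchanged. The bound is a sum rather than
    a maximum, so that closure of class K-infinity under sums and compositions suffices later. *)
Lemma small_gain_bound (R : realType) (g1 g2 : R -> R) (b1 b2 y1 y2 : R) :
  class_Kinf g1 -> class_Kinf g2 -> class_Kinf (fun s => s - g1 (g2 s)) ->
  0 <= b1 -> 0 <= b2 -> 0 <= y1 -> 0 <= y2 ->
  y1 <= Num.max b1 (g1 y2) -> y2 <= Num.max b2 (g2 y1) ->
  y1 <= b1 + g1 b2.
Proof.
move=> g1K g2K [_ inc sg0 _] b10 b20 y10 y20.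
have gb0 := Kinf_ge0 g1K b20.
rewrite le_max => /orP[y1b|y1g]; first by rewrite (le_trans y1b)// lerDl.
rewrite le_max => /orP[y2b|y2g].
  by rewrite (le_trans y1g)// (le_trans (Kinf_le g1K y20 y2b))// lerDr.
have {y1g}y1g := le_trans y1g (Kinf_le g1K y20 y2g).
move: y10; rewrite le_eqVlt => /predU1P[<-|/(inc _ _ (lexx 0))].
  by rewrite addr_ge0.
by rewrite sg0 subr_gt0 ltNge y1g.
Qed.

(** * The Euclidean norm of a vector and of its two blocks *)

Section euclidean_norm.
Context {R : realType}.

Lemma enorm_ge0 n (v : 'cV[R]_n) : 0 <= enorm v.
Proof. exact: sqrtr_ge0. Qed.

Lemma enorm_sqr n (v : 'cV[R]_n) : enorm v ^+ 2 = \sum_i v i ord0 ^+ 2.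
Proof. by rewrite sqr_sqrtr// sumr_ge0// => i _; exact: sqr_ge0. Qed.

Lemma ler_coord_enorm n (v : 'cV[R]_n) i : `|v i ord0| <= enorm v.
Proof.
rewrite -ler_sqr ?nnegrE ?enorm_ge0// enorm_sqr -normrX ger0_norm ?sqr_ge0//.
by rewrite (bigD1 i)//= lerDl sumr_ge0// => j _; exact: sqr_ge0.
Qed.

Lemma enorm_split n1 n2 (v : 'cV[R]_(n1 + n2)) :
  enorm v ^+ 2 = enorm (usubmx v) ^+ 2 + enorm (dsubmx v) ^+ 2.
Proof.
rewrite !enorm_sqr big_split_ord/=.
by congr (_ + _); apply: eq_bigr => i _; rewrite mxE.
Qed.

Lemma ler_enorm_usubmx n1 n2 (v : 'cV[R]_(n1 + n2)) : enorm (usubmx v) <= enorm v.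
Proof.
by rewrite -ler_sqr ?nnegrE ?enorm_ge0// enorm_split lerDl sqr_ge0.
Qed.

Lemma ler_enorm_dsubmx n1 n2 (v : 'cV[R]_(n1 + n2)) : enorm (dsubmx v) <= enorm v.
Proof.
by rewrite -ler_sqr ?nnegrE ?enorm_ge0// enorm_split lerDr sqr_ge0.
Qed.

End euclidean_norm.

(** * Regularity of solutions and of their blocks *)

Section solutions.
Context {R : realType}.

Lemma loc_absolutely_continuous_contraction n m (h : 'cV[R]_n -> 'cV[R]_m)
    (x : R -> 'cV[R]_n) :
  (forall u v, enorm (h u - h v) <= enorm (u - v)) ->
  loc_absolutely_continuous x -> loc_absolutely_continuous (h \o x).
Proof.
move=> hh xac T e T0 e0; have [d d0 xd] := xac T e T0 e0; exists d => //.
move=> N a b abT tab sab; apply: le_lt_trans (xd N a b abT tab sab).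
by apply: ler_sum => k _; exact: hh.
Qed.

(** Derivatives of matrix-valued maps are taken entrywise. Selecting rows along an arbitrary [h]
    covers both blocks, through [lshift] and [rshift]. *)
Lemma is_derive_rowsub n m (h : 'I_m -> 'I_n) (x : R -> 'cV[R]_n) (t : R) dx :
  is_derive t 1 x dx -> is_derive t 1 (rowsub h \o x) (rowsub h dx).
Proof.
move=> [xt <-].
have dxt : derivable (rowsub h \o x) t 1.
  apply/derivable_mxP => i j.
  rewrite (_ : (fun _ => _) = (fun s => x s (h i) j)); last first.
    by apply/funext => s; rewrite /= mxE.
  by move/derivable_mxP : xt; exact.
split => //; rewrite !derive_mx//; apply/matrixP => i j; rewrite !mxE.
by congr ('D_1 _ t); apply/funext => s; rewrite /= mxE.
Qed.

Lemma continuous_coord_loc_absolutely_continuous n (x : R -> 'cV[R]_n) i :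
  loc_absolutely_continuous x ->
  {within `[0, +oo[, continuous (fun t => x t i ord0)}.
Proof.
move=> xac; apply/subspace_continuousP => s /=.
rewrite in_itv/= andbT => s0; apply/cvgrPdist_lt => e e0.
(* The horizon [s + 1] leaves room to the right of [s]; absolute continuity is then used for a
   single interval. *)
have [d d0 xd] := xac (s + 1) e (addr_ge0 s0 ler01) e0.
have xd1 a b : 0 <= a -> a <= b -> b <= s + 1 -> b - a < d ->
    `|x b i ord0 - x a i ord0| < e.
  move=> a0 ab bs bad.
  have abT (k : 'I_1) : [/\ 0 <= a, a <= b & b <= s + 1] by [].
  have tab : trivIset setT (fun k : 'I_1 => [set` `]a, b[]).
    by move=> j k _ _ _; rewrite [j]ord1 [k]ord1.
  have := xd 1%N (fun=> a) (fun=> b) abT tab; rewrite !big_ord1 => /(_ bad).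
  by apply: le_lt_trans; have := ler_coord_enorm (x b - x a) i; rewrite !mxE.
near=> r.
have r0 : 0 <= r.
  by have : [set` `[0, +oo[] r; [near: r; exact: withinT | rewrite /= in_itv/= andbT].
have rs1 : r <= s + 1.
  have : `|s - r| < 1 by near: r; apply: cvg_within; exact: nbhsx_ballx.
  by rewrite ltr_distlC addrC => /andP[_ /ltW]; rewrite addrC.
have : `|s - r| < d by near: r; apply: cvg_within; exact: nbhsx_ballx.
have [sr|rs] := leP s r.
  by rewrite distrC ger0_norm ?subr_ge0// distrC; exact: xd1.
by rewrite ger0_norm ?subr_ge0 ?(ltW rs)//; apply: xd1 => //; rewrite ?(ltW rs)// lerDl.
Unshelve. all: by end_near. Qed.

(** * Measurability and integrability for the completed Lebesgue measure *)

Lemma borel_completed_measurable (A : set R) :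
  measurable A -> @measurable _ (lebesgue_type R) A.
Proof. exact: sub_caratheodory. Qed.

Lemma within_continuous_lebesgue_measurable (D : set R) (f : R -> R) :
  measurable D -> {within D, continuous f} -> lebesgue_measurable_fun D f.
Proof.
move=> mD cf _ Y mY; apply: borel_completed_measurable.
exact: (measurable_realfun.subspace_continuous_measurable_fun mD cf).
Qed.

Lemma within_continuous_completed_integrable (f : R -> R) (t : R) :
  {within `[0, t], continuous f} ->
  (@completed_lebesgue_measure R).-integrable `[0, t] (EFin \o f).
Proof.
move=> cf; apply: measurable_bounded_integrable.
- exact: borel_completed_measurable.
(* Both measures come from the same outer measure, hence agree by definition. The case distinction
   covers [t <= 0], where the value is 0. *)
- rewrite [X in (X < _)%E](_ : _ = @lebesgue_measure R `[0, t])//.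
  by rewrite lebesgue_measure_itv/=; case: ifP; rewrite ?ltry.
- exact: within_continuous_lebesgue_measurable.
- have /compact_bounded[M [Mr MB]] : compact (f @` `[0, t]).
    by apply: continuous_compact => //; exact: segment_compact.
  by exists M; split => // y My s st; apply: MB => //; exists s.
Qed.

(** Squaring removes the root and leaves a polynomial in the coordinates. *)
Lemma within_continuous_enorm_sqr n (x : R -> 'cV[R]_n) :
  loc_absolutely_continuous x ->
  {within `[0, +oo[, continuous (fun t => enorm (x t) ^+ 2)}.
Proof.
move=> xac.
rewrite (_ : (fun _ => _) = fun t => \sum_i x t i ord0 ^+ 2); last first.
  by apply/funext => t; exact: enorm_sqr.
move=> s; apply: (cvg_big (@add_continuous R)) => i _.
by apply: (@cvgM R); exact: continuous_coord_loc_absolutely_continuous.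
Qed.

Lemma enorm_sqr_integrable n (x : R -> 'cV[R]_n) t :
  loc_absolutely_continuous x ->
  (@completed_lebesgue_measure R).-integrable `[0, t]
    (EFin \o (fun s => enorm (x s) ^+ 2)).
Proof.
move=> xac; apply: within_continuous_completed_integrable.
apply: continuous_subspaceW (within_continuous_enorm_sqr xac).
by apply: subset_itvl; rewrite bnd_simp.
Qed.

Lemma loc_absolutely_continuous_input n (x : R -> 'cV[R]_n) :
  loc_absolutely_continuous x -> input_class x.
Proof.
move=> xac; split=> [i|T T0].
  apply: within_continuous_lebesgue_measurable => //.
  exact: continuous_coord_loc_absolutely_continuous.
have xc : {within `[0, T], continuous (fun t => enorm (x t) ^+ 2)}.
  apply: continuous_subspaceW (within_continuous_enorm_sqr xac).
  by apply: subset_itvl; rewrite bnd_simp.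
(* The norm at a maximiser [c] of the square bounds the norm on all of [[0, T]], hence almost
   everywhere. *)
have [c _ xmax] := EVT_max T0 xc.
exists (enorm (x c)); apply: aeW => t tT.
rewrite -ler_sqr ?nnegrE ?enorm_ge0//; apply: xmax.
by rewrite in_itv/=.
Qed.

(** * Splitting norms and closed-loop solutions into blocks *)

Lemma L2sq_ge0 n (x : R -> 'cV[R]_n) t : 0 <= L2sq x t.
Proof. by apply: Rintegral_ge0 => s _; exact: sqr_ge0. Qed.

Lemma L2sq_split n1 n2 (x : R -> 'cV[R]_(n1 + n2)) t :
  loc_absolutely_continuous (usubmx \o x) ->
  loc_absolutely_continuous (dsubmx \o x) ->
  L2sq x t = L2sq (usubmx \o x) t + L2sq (dsubmx \o x) t.
Proof.
move=> xu xd; rewrite /L2sq -RintegralD.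
- by apply: eq_Rintegral => s _; rewrite enorm_split.
- exact: borel_completed_measurable.
- exact: enorm_sqr_integrable.
- exact: enorm_sqr_integrable.
Qed.

Lemma interconnection_usubmx n1 n2 (f1 : 'cV[R]_n1 -> 'cV[R]_n2 -> 'cV[R]_n1)
    (f2 : 'cV[R]_n2 -> 'cV[R]_n1 -> 'cV[R]_n2) (x : R -> 'cV[R]_(n1 + n2)) :
  is_autonomous_solution (interconnection f1 f2) x ->
  is_input_solution f1 (dsubmx \o x) (usubmx \o x).
Proof.
move=> [xac xd]; split.
  apply: loc_absolutely_continuous_contraction xac => u v.
  by rewrite -linearB ler_enorm_usubmx.
(* The block satisfies its equation wherever [x] does, so its exceptional set lies in the negligible
   one of [x]. *)
apply: negligibleS xd; apply: subsetC => t /= + t0 => /(_ t0).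
move=> /(is_derive_rowsub (lshift n2)).
rewrite -usubmxEsub /interconnection col_mxKu.
by congr is_derive; apply/funext => s; rewrite /= usubmxEsub.
Qed.

Lemma interconnection_dsubmx n1 n2 (f1 : 'cV[R]_n1 -> 'cV[R]_n2 -> 'cV[R]_n1)
    (f2 : 'cV[R]_n2 -> 'cV[R]_n1 -> 'cV[R]_n2) (x : R -> 'cV[R]_(n1 + n2)) :
  is_autonomous_solution (interconnection f1 f2) x ->
  is_input_solution f2 (usubmx \o x) (dsubmx \o x).
Proof.
move=> [xac xd]; split.
  apply: loc_absolutely_continuous_contraction xac => u v.
  by rewrite -linearB ler_enorm_dsubmx.
apply: negligibleS xd; apply: subsetC => t /= + t0 => /(_ t0).
move=> /(is_derive_rowsub (@rshift n1 n2)).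
rewrite -dsubmxEsub /interconnection col_mxKd.
by congr is_derive; apply/funext => s; rewrite /= dsubmxEsub.
Qed.

End solutions.

Theorem theorem4 (R : realType) (n1 n2 : nat)
    (f1 : 'cV[R]_n1 -> 'cV[R]_n2 -> 'cV[R]_n1)
    (f2 : 'cV[R]_n2 -> 'cV[R]_n1 -> 'cV[R]_n2)
    (beta1 gamma1 beta2 gamma2 : R -> R)
    (f1_lip : lipschitz_loc_unif f1) (f2_lip : lipschitz_loc_unif f2)
    (f1_fc : forward_complete f1) (f2_fc : forward_complete f2)
    (beta1K : class_Kinf beta1) (gamma1K : class_Kinf gamma1)
    (beta2K : class_Kinf beta2) (gamma2K : class_Kinf gamma2)
    (gain1 : L2_gain_estimate f1 beta1 gamma1)
    (gain2 : L2_gain_estimate f2 beta2 gamma2)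
    (inter_fc : forward_complete_autonomous (interconnection f1 f2))
    (small_gain12 : class_Kinf (fun s => s - gamma1 (gamma2 s)))
    (small_gain21 : class_Kinf (fun s => s - gamma2 (gamma1 s))) :
  L2_stable (interconnection f1 f2).
Proof.
(* The first bracket will bound the squared norm of the upper block, the second that of the lower
   block. *)
exists (fun s => (beta1 s + gamma1 (beta2 s)) + (beta2 s + gamma2 (beta1 s))).
  by do 2?apply: class_KinfD => //; exact: class_Kinf_comp.
move=> x t xsol t0.
have sol1 := interconnection_usubmx xsol.
have sol2 := interconnection_dsubmx xsol.
have [ac1 _] := sol1; have [ac2 _] := sol2.
have y1 := gain1 _ _ _ (loc_absolutely_continuous_input ac2) sol1 t0.
have y2 := gain2 _ _ _ (loc_absolutely_continuous_input ac1) sol2 t0.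
have b10 := Kinf_ge0 beta1K (enorm_ge0 (usubmx (x 0))).
have b20 := Kinf_ge0 beta2K (enorm_ge0 (dsubmx (x 0))).
(* The gain estimates involve the norms of the blocks of [x 0]; monotonicity replaces these by the
   norm of [x 0] itself. *)
have b1le := Kinf_le beta1K (enorm_ge0 _) (ler_enorm_usubmx (x 0)).
have b2le := Kinf_le beta2K (enorm_ge0 _) (ler_enorm_dsubmx (x 0)).
rewrite L2sq_split//; apply: lerD.
- apply: le_trans (small_gain_bound gamma1K gamma2K small_gain12 b10 b20
    (L2sq_ge0 _ _) (L2sq_ge0 _ _) y1 y2) _.
  by rewrite lerD// Kinf_le.
- apply: le_trans (small_gain_bound gamma2K gamma1K small_gain21 b20 b10
    (L2sq_ge0 _ _) (L2sq_ge0 _ _) y2 y1) _.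
  by rewrite lerD// Kinf_le.
Qed.
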